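(* Let $P$, $Q$, $R$ be MIAs with common input alphabet $I$ and common output alphabet $O$, where $P$ and $Q$ have disjoint state sets, and let $p\in P$, $q\in Q$, $r\in R$. Then $p\vee q\sqsubseteq_{\mathrm{MIA}} r$ if and only if $p\sqsubseteq_{\mathrm{MIA}} r$ and $q\sqsubseteq_{\mathrm{MIA}} r$.
   Context: A dMTS is $(P,A,\longrightarrow_P,\dashrightarrow_P)$ with states $P$, alphabet $A$ not containing $\tau$, must-relation $\longrightarrow_P\subseteq P\times A\times(2^P\setminus\{\emptyset\})$, may-relation $\dashrightarrow_P\subseteq P\times(A\cup\{\tau\})\times P$, and syntactic consistency ($p\xrightarrow{a}P'$ implies $p\stackrel{a}{\dashrightarrow}p'$ for all $p'\in P'$). A Modal Interface Automaton (MIA) is $(P,I,O,\longrightarrow_P,\dashrightarrow_P)$ with $I,O$ disjoint such that $(P,I\cup O,\longrightarrow_P,\dashrightarrow_P)$ is a dMTS and for all $i\in I$: (a) $p\xrightarrow{i}P'$ and $p\xrightarrow{i}P''$ imply $P'=P''$; (b) $p\stackrel{i}{\dashrightarrow}p'$ implies $p\xrightarrow{i}P'$ for some $P'\ni p'$. Write $p\stackrel{a}{\dashrightarrow}$ if some may-$a$-transition leaves $p$. Weak may: $p\stackrel{\epsilon}{\Longrightarrow}p'$ iff $p(\stackrel{\tau}{\dashrightarrow})^*p'$; $p\stackrel{\alpha}{\Longrightarrow}p'$ iff $\exists p''.\,p\stackrel{\epsilon}{\Longrightarrow}p''\stackrel{\alpha}{\dashrightarrow}p'$; $\hat\tau=\epsilon$,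 $\hat a=a$. For MIAs $P,Q$ with the same $I,O$, $\mathcal R\subseteq P\times Q$ is a MIA-refinement relation if for all $(p,q)\in\mathcal R$: (i) $q\xrightarrow{a}Q'$ ($a\in I\cup O$) implies some $P'$ with $p\xrightarrow{a}P'$ and $\forall p'\in P'\,\exists q'\in Q'.\,(p',q')\in\mathcal R$; (ii) $p\stackrel{\alpha}{\dashrightarrow}p'$ with $\alpha\in O\cup\{\tau\}$ implies some $q'$ with $q\stackrel{\hat\alpha}{\Longrightarrow}q'$ and $(p',q')\in\mathcal R$. $p\sqsubseteq_{\mathrm{MIA}}q$ iff some such relation contains $(p,q)$. MIA-disjunction: for MIAs $P,Q$ with common $I,O$ and disjoint state sets, $P\vee Q$ has state set $\{p\vee q:p\in P,q\in Q\}\cup P\cup Q$, alphabets $I,O$, and the least must- and may-transition relations containing those of $P$ and $Q$ and satisfying: (Must) $p\vee q\xrightarrow{a}P'\cup Q'$ if $p\xrightarrow{a}_PP'$ and $q\xrightarrow{a}_QQ'$; (May1) $p\vee q\stackrel{\alpha}{\dashrightarrow}p'$ if $p\stackrel{\alpha}{\dashrightarrow}_Pp'$ and, in case $\alpha\in I$, also $q\stackrel{\alpha}{\dashrightarrow}_Q$; (May2) $p\vee q\stackrel{\alpha}{\dashrightarrow}q'$ if $q\stackrel{\alpha}{\dashrightarrow}_Qq'$ and, in case $\alpha\in I$, also $p\stackrel{\alpha}{\dashrightarrow}_P$. *)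

(* Defs.v *)
From Stdlib Require Import Relation_Operators.
From mathcomp Require Import all_boot.
From mathcomp Require Import classical_sets.

Set Implicit Arguments.
Unset Strict Implicit.
Unset Printing Implicit Defensive.

Local Open Scope classical_set_scope.

(* Transition labels over a universe [Act] of visible actions: [Some a] is the
   visible action [a] and [None] is the internal action tau, which therefore
   lies outside every alphabet [A : set Act]. *)
Notation label Act := (option Act).
Notation tau := None.

Record dMTS (Act : Type) (A : set Act) := MkdMTS {
  state :> Type;
  must : state -> Act -> set state -> Prop;
  may : state -> label Act -> state -> Prop;
  must_alphabet : forall p a P', must p a P' -> A a;
  must_nonempty : forall p a P', must p a P' -> P' !=set0;
  may_alphabet : forall p a p', may p (Some a) p' -> A a;
  syntactic_consistency :
    forall p a P', must p a P' -> forall p', P' p' -> may p (Some a) p'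
}.

Record MIA (Act : Type) (I O : set Act) := MkMIA {
  mia_dMTS :> dMTS (I `|` O);
  io_disjoint : I `&` O = set0;
  input_deterministic : forall (p : mia_dMTS) i P' P'',
    I i -> must p i P' -> must p i P'' -> P' = P'';
  input_may_must : forall (p : mia_dMTS) i p',
    I i -> may p (Some i) p' -> exists2 P', must p i P' & P' p'
}.

Section WeakMay.
Variables (Act : Type) (A : set Act) (P : dMTS A).

Definition has_may (p : P) (l : label Act) : Prop := exists p', may p l p'.

Definition weak_eps : P -> P -> Prop :=
  clos_refl_trans P (fun p p' => may p tau p').

Definition weak_may (p : P) (l : label Act) (p' : P) : Prop :=
  exists2 p'', weak_eps p p'' & may p'' l p'.

(* The weak transition labelled by the "hat" of [l]: a trailing sequence of
   tau's is not allowed after a visible action. *)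
Definition weak_hat (p : P) (l : label Act) (p' : P) : Prop :=
  match l with
  | tau => weak_eps p p'
  | Some a => weak_may p (Some a) p'
  end.

End WeakMay.

Section Refinement.
Variables (Act : Type) (I O : set Act) (P Q : MIA I O).

Definition output_or_tau (l : label Act) : Prop :=
  match l with tau => True | Some a => O a end.

Definition is_MIA_refinement (S : P -> Q -> Prop) : Prop :=
  forall p q, S p q ->
    (forall a Q', (I `|` O) a -> must q a Q' ->
       exists2 P', must p a P' &
         forall p', P' p' -> exists2 q', Q' q' & S p' q') /\
    (forall l p', output_or_tau l -> may p l p' ->
       exists2 q', weak_hat q l q' & S p' q').

Definition MIA_refines (p : P) (q : Q) : Prop :=
  exists2 S, is_MIA_refinement S & S p q.

End Refinement.

Section Disjunction.
Variables (Act : Type) (I O : set Act) (P Q : MIA I O).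

(* The state sets of [P] and [Q] are made disjoint by the constructors. *)
Inductive disj_state : Type :=
  | Disj of P & Q
  | InL of P
  | InR of Q.

Definition in_case_input (l : label Act) (C : Prop) : Prop :=
  forall i, l = Some i -> I i -> C.

Inductive disj_must : disj_state -> Act -> set disj_state -> Prop :=
  | DMustL p a P' : must p a P' -> disj_must (InL p) a (InL @` P')
  | DMustR q a Q' : must q a Q' -> disj_must (InR q) a (InR @` Q')
  | DMust p q a P' Q' : must p a P' -> must q a Q' ->
      disj_must (Disj p q) a (InL @` P' `|` InR @` Q').

Inductive disj_may : disj_state -> label Act -> disj_state -> Prop :=
  | DMayL p l p' : may p l p' -> disj_may (InL p) l (InL p')
  | DMayR q l q' : may q l q' -> disj_may (InR q) l (InR q')
  | DMay1 p q l p' : may p l p' -> in_case_input l (has_may q l) ->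
      disj_may (Disj p q) l (InL p')
  | DMay2 p q l q' : may q l q' -> in_case_input l (has_may p l) ->
      disj_may (Disj p q) l (InR q').

Lemma disj_must_alphabet s a S : disj_must s a S -> (I `|` O) a.
Proof. by case=> {s a S} * ; apply: must_alphabet; eassumption. Qed.

Lemma disj_must_nonempty s a S : disj_must s a S -> S !=set0.
Proof.
case=> {s a S} [p a P' pP'|q a Q' qQ'|p q a P' Q' pP' _].
- by have [x Px] := must_nonempty pP'; exists (InL x); exists x.
- by have [x Qx] := must_nonempty qQ'; exists (InR x); exists x.
- by have [x Px] := must_nonempty pP'; exists (InL x); left; exists x.
Qed.

Lemma disj_may_alphabet s a s' : disj_may s (Some a) s' -> (I `|` O) a.
Proof.
by move=> ss'; inversion ss'; subst; apply: may_alphabet; eassumption.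
Qed.

Lemma must_has_may (M : MIA I O) (p : M) a P' :
  must p a P' -> has_may p (Some a).
Proof.
move=> pP'; have [p' P'p'] := must_nonempty pP'.
by exists p'; exact: syntactic_consistency pP' _ P'p'.
Qed.

Lemma disj_syntactic_consistency s a S :
  disj_must s a S -> forall s', S s' -> disj_may s (Some a) s'.
Proof.
case=> {s a S} [p a P' pP' _ [x Px <-]|q a Q' qQ' _ [x Qx <-]
               |p q a P' Q' pP' qQ' _ [[x Px <-]|[x Qx <-]]].
- by apply: DMayL; exact: syntactic_consistency pP' _ Px.
- by apply: DMayR; exact: syntactic_consistency qQ' _ Qx.
- apply: DMay1; first exact: syntactic_consistency pP' _ Px.
  by move=> *; exact: must_has_may qQ'.
- apply: DMay2; first exact: syntactic_consistency qQ' _ Qx.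
  by move=> *; exact: must_has_may pP'.
Qed.

Definition disj_dMTS : dMTS (I `|` O) :=
  MkdMTS disj_must_alphabet disj_must_nonempty disj_may_alphabet
    disj_syntactic_consistency.

Lemma disj_input_deterministic (s : disj_dMTS) i S S' :
  I i -> must s i S -> must s i S' -> S = S'.
Proof.
move=> + sS; case: sS => {s i S} [p i P1 pP1|q i Q1 qQ1|p q i P1 Q1 pP1 qQ1] Ii.
all: move=> sS'; inversion sS'; subst.
- by congr (_ @` _); apply: input_deterministic Ii pP1 _.
- by congr (_ @` _); apply: input_deterministic Ii qQ1 _.
- by congr setU; congr (_ @` _);
    [apply: input_deterministic Ii pP1 _|apply: input_deterministic Ii qQ1 _].
Qed.

Lemma disj_input_may_must (s : disj_dMTS) i s' :
  I i -> may s (Some i) s' -> exists2 S, must s i S & S s'.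
Proof.
move=> Ii ss'; inversion ss' as [p l p' pp'|q l q' qq'
  |p q l p' pp' C|p q l q' qq' C]; subst.
- have [P1 pP1 P1p'] := input_may_must Ii pp'.
  by exists (InL @` P1); [exact: DMustL|exists p'].
- have [Q1 qQ1 Q1q'] := input_may_must Ii qq'.
  by exists (InR @` Q1); [exact: DMustR|exists q'].
- have [P1 pP1 P1p'] := input_may_must Ii pp'.
  have [x qx] := C i erefl Ii; have [Q1 qQ1 _] := input_may_must Ii qx.
  by exists (InL @` P1 `|` InR @` Q1); [exact: DMust|left; exists p'].
- have [Q1 qQ1 Q1q'] := input_may_must Ii qq'.
  have [x px] := C i erefl Ii; have [P1 pP1 _] := input_may_must Ii px.
  by exists (InL @` P1 `|` InR @` Q1); [exact: DMust|right; exists q'].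
Qed.

Definition MIA_disj : MIA I O :=
  @MkMIA Act I O disj_dMTS (io_disjoint P) disj_input_deterministic
    disj_input_may_must.

End Disjunction.

Arguments Disj {Act I O P Q} _ _.
Arguments InL {Act I O P Q} _.
Arguments InR {Act I O P Q} _.

(* Main.v *)
(** A refinement relation [S] for [p \/ q] restricts to one for [p]: relate [p]
to [r] when [S] relates to [r] either [p] itself or some [p \/ q].  This works
because every must-transition of [p \/ q] projects to one of [p], and every
output- or tau-transition of [p] is one of [p \/ q] (the side condition of the
May-rules only concerns inputs, which are not outputs).  Conversely, refinement
relations for [p] and for [q] glue to one for [p \/ q], which is related to [r]
when both [p] and [q] are. *)

Require Import Defs.
From mathcomp Require Import all_boot.
From mathcomp Require Import classical_sets.

Section DisjunctionRefinement.
Variables (Act : Type) (I O : set Act) (P Q R : MIA I O).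

Lemma in_case_input_output (l : label Act) (C : Prop) :
  output_or_tau O l -> in_case_input I l C.
Proof.
move=> Ol i li Ii; rewrite li /= in Ol.
(* Disjointness of [I] and [O] is a field of the MIA [P]. *)
by have : (I `&` O)%classic i by []; rewrite (io_disjoint P).
Qed.

Lemma refines_disjl (p : P) (q : Q) (r : R) :
  MIA_refines (Disj p q : MIA_disj P Q) r -> MIA_refines p r.
Proof.
case=> S refS Spqr.
(* The second disjunct covers the starting pair; every matched transition then leads into the first,
   as all targets used have the form [InL p']. *)
exists (fun p r => S (InL p) r \/ exists q, S (Disj p q) r); last first.
  by right; exists q.
move=> {p q r Spqr} p r [/refS|[q /refS]] [Smust Smay]; split.
- move=> a R' Aa /(Smust _ _ Aa)[X pX XR'].
  inversion pX as [? ? P' pP'| |]; subst; exists P' => // p' P'p'.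
  have [|r' R'r' Sr'] := XR' (InL p'); first by exists p'.
  by exists r' => //; left.
- move=> l p' Ol pp'.
  by have [|r' rr' Sr'] := Smay l (InL p') Ol;
    [exact: DMayL|exists r' => //; left].
- move=> a R' Aa /(Smust _ _ Aa)[X pX XR'].
  inversion pX as [| |? ? ? P' Q' pP' qQ']; subst; exists P' => // p' P'p'.
  have [|r' R'r' Sr'] := XR' (InL p'); first by left; exists p'.
  by exists r' => //; left.
- move=> l p' Ol pp'.
  by have [|r' rr' Sr'] := Smay l (InL p') Ol;
    [apply: DMay1 => //; exact: in_case_input_output|exists r' => //; left].
Qed.

(** Mirror image of [refines_disjl], with [DMay2] in place of [DMay1]. *)
Lemma refines_disjr (p : P) (q : Q) (r : R) :
  MIA_refines (Disj p q : MIA_disj P Q) r -> MIA_refines q r.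
Proof.
case=> S refS Spqr.
exists (fun q r => S (InR q) r \/ exists p, S (Disj p q) r); last first.
  by right; exists p.
move=> {p q r Spqr} q r [/refS|[p /refS]] [Smust Smay]; split.
- move=> a R' Aa /(Smust _ _ Aa)[X qX XR'].
  inversion qX as [|? ? Q' qQ'|]; subst; exists Q' => // q' Q'q'.
  have [|r' R'r' Sr'] := XR' (InR q'); first by exists q'.
  by exists r' => //; left.
- move=> l q' Ol qq'.
  by have [|r' rr' Sr'] := Smay l (InR q') Ol;
    [exact: DMayR|exists r' => //; left].
- move=> a R' Aa /(Smust _ _ Aa)[X qX XR'].
  inversion qX as [| |? ? ? P' Q' pP' qQ']; subst; exists Q' => // q' Q'q'.
  have [|r' R'r' Sr'] := XR' (InR q'); first by right; exists q'.
  by exists r' => //; left.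
- move=> l q' Ol qq'.
  by have [|r' rr' Sr'] := Smay l (InR q') Ol;
    [apply: DMay2 => //; exact: in_case_input_output|exists r' => //; left].
Qed.

Lemma disj_refines (p : P) (q : Q) (r : R) :
  MIA_refines p r -> MIA_refines q r ->
  MIA_refines (Disj p q : MIA_disj P Q) r.
Proof.
case=> S refS Spr [T refT Tqr].
(* [Disj p q] needs both relations: by [DMust], a must-transition of [r] has to be matched by [p]
   and by [q] at once. *)
pose U (s : MIA_disj P Q) r := match s with
  | Disj p q => S p r /\ T q r
  | InL p => S p r
  | InR q => T q r
  end.
exists U => // {p q r Spr Tqr} -[p q|p|q] r.
- case=> /refS[Smust Smay] /refT[Tmust Tmay]; split.
  + move=> a R' Aa rR'.
    have [P' pP' P'R'] := Smust _ _ Aa rR'.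
    have [Q' qQ' Q'R'] := Tmust _ _ Aa rR'.
    exists (InL @` P' `|` InR @` Q')%classic; first exact: DMust.
    by move=> _ [[p' /P'R' ? <-]|[q' /Q'R' ? <-]].
  (* A may-transition commits to one component, where [U] reduces to [S] or to [T] alone. *)
  + move=> l s Ol ps; inversion ps as [| |? ? ? p' pp'|? ? ? q' qq']; subst.
    * exact: Smay.
    * exact: Tmay.
- move=> /refS[Smust Smay]; split.
  + move=> a R' Aa /(Smust _ _ Aa)[P' pP' P'R'].
    exists (InL @` P')%classic; first exact: DMustL.
    by move=> _ [p' /P'R' ? <-].
  + by move=> l s Ol ps; inversion ps; subst; exact: Smay.
- move=> /refT[Tmust Tmay]; split.
  + move=> a R' Aa /(Tmust _ _ Aa)[Q' qQ' Q'R'].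
    exists (InR @` Q')%classic; first exact: DMustR.
    by move=> _ [q' /Q'R' ? <-].
  + by move=> l s Ol qs; inversion qs; subst; exact: Tmay.
Qed.

End DisjunctionRefinement.

Theorem theorem4p10 (Act : Type) (I O : set Act) (P Q R : MIA I O)
    (p : P) (q : Q) (r : R) :
  MIA_refines (Disj p q : MIA_disj P Q) r <->
  MIA_refines p r /\ MIA_refines q r.
Proof.
split=> [pqr|[]]; last exact: disj_refines.
by split; [exact: refines_disjl pqr|exact: refines_disjr pqr].
Qed.
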